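(* Let $S$ be a $\mathrm{Cu}$-semigroup and let $x,y\in\mathrm{Full}(S)$. Then the following are equivalent: (1) $\rho(x,y)=0$. (2) $\mathcal{F}_y(S)=\emptyset$.
   Context: For elements $x,y$ of a partially ordered set $P$, $x\ll y$ means: for every increasing sequence $(y_n)$ in $P$ with supremum $y$ there is $n_0$ with $x\leq y_{n_0}$. A $\mathrm{Cu}$-semigroup is a positively ordered abelian monoid $S$ (so $0\leq x$ for all $x$ and the order is compatible with addition) such that: (O1) every increasing sequence in $S$ has a supremum; (O2) every $x\in S$ is the supremum of a sequence $x_0\ll x_1\ll x_2\ll\cdots$; (O3) if $x'\ll x$ and $y'\ll y$ then $x'+y'\ll x+y$; (O4) $\sup_n(x_n+y_n)=\sup_n x_n+\sup_n y_n$ for all increasing sequences $(x_n),(y_n)$. For $x\in S$, $\infty\cdot x=\sup_n n\cdot x$. An element $x$ is full if $\infty\cdot x$ is the largest element of $S$; $\mathrm{Full}(S)$ is the set of full elements. A functional on $S$ is a map $\lambda\colon S\to[0,\infty]$ that is additive, order preserving, satisfies $\lambda(0)=0$, and preserves suprema of increasing sequences. $\mathcal{F}(S)$ is the set of functionals on $S$, and $\mathcal{F}_z(S)=\{\lambda\in\mathcal{F}(S):\lambda(z)=1\}$ for $z\in S$. The rank of $x$ is $\widehat{x}\colon\mathcal{F}(S)\to[0,\infty]$, $\widehat{x}(\lambda)=\lambda(x)$. Rank ratio: $\rho(x,y)=\inf\{r\in(0,\infty):\widehat{x}\leq r\cdot\widehat{y}\}$ (pointwise inequality on $\mathcal{F}(S)$),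 with $\rho(x,y)=\infty$ if there is no such $r$. *)

(* Defs.v *)
From HB Require Import structures.
From mathcomp Require Import all_boot all_order all_algebra.
From mathcomp Require Import all_classical all_reals ereal sequences.

Set Implicit Arguments.
Unset Strict Implicit.
Unset Printing Implicit Defensive.

Import Order.TTheory GRing.Theory Num.Theory.
Local Open Scope classical_set_scope.
Local Open Scope ring_scope.

(* A plain record rather than a Hierarchy-Builder structure: the library's
   porderZmodType would have to inherit from a structure joining porderType
   and nmodType, so such a join cannot be declared after it. *)
Record pomType (d : Order.disp_t) := PomType {
  pom_order : porderType d;
  pom_zero : pom_order;
  pom_add : pom_order -> pom_order -> pom_order;
  pom_addA : associative pom_add;
  pom_addC : commutative pom_add;
  pom_add0 : left_id pom_zero pom_add;
  pom_ge0 : forall x, (pom_zero <= x)%O;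
  pom_leD : forall x x' y y', (x <= x')%O -> (y <= y')%O ->
    (pom_add x y <= pom_add x' y')%O
}.

Definition pom_sort d (S : pomType d) : Type := pom_order S.
Coercion pom_sort : pomType >-> Sortclass.

Section PomInstances.
Context {d : Order.disp_t} {S : pomType d}.
HB.instance Definition _ := Order.POrder.copy (pom_sort S) (pom_order S).
HB.instance Definition _ := GRing.isNmodule.Build (pom_sort S)
  (@pom_addA d S) (@pom_addC d S) (@pom_add0 d S).
End PomInstances.

(* [supremums A] is the set of least upper bounds of A, a subsingleton. *)
Definition way_below d (P : porderType d) (x y : P) : Prop :=
  forall u : nat -> P, nondecreasing_seq u -> supremums (range u) y ->
    exists n, (x <= u n)%O.

Record is_Cu d (S : pomType d) : Prop := IsCu {
  Cu_O1 : forall u : nat -> S, nondecreasing_seq u ->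
    exists s, supremums (range u) s;
  Cu_O2 : forall x : S, exists u : nat -> S,
    (forall n, way_below (u n) (u n.+1)) /\ supremums (range u) x;
  Cu_O3 : forall x' x y' y : S, way_below x' x -> way_below y' y ->
    way_below (x' + y' : S) (x + y : S);
  Cu_O4 : forall (u v : nat -> S) (s t : S),
    nondecreasing_seq u -> nondecreasing_seq v ->
    supremums (range u) s -> supremums (range v) t ->
    supremums (range (fun n => u n + v n : S)) (s + t : S)
}.

Section CuDefinitions.
Context {d : Order.disp_t} {S : pomType d}.

(* The default value 0 of [supremum] is not used when (O1) holds. *)
Definition infty_mul (x : S) : S :=
  supremum (0 : S) (range (fun n => x *+ n : S)).

Definition Full : set S := [set x | forall z : S, (z <= infty_mul x)%O].

Variable R : realType.
Local Open Scope ereal_scope.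

Record is_functional (l : S -> \bar R) : Prop := IsFunctional {
  functional_ge0 : forall x : S, 0 <= l x;
  functional0 : l 0%R = 0;
  functionalD : forall x y : S, l (x + y)%R = l x + l y;
  functional_le : forall x y : S, (x <= y)%O -> l x <= l y;
  functional_sup : forall (u : nat -> S) (s : S), nondecreasing_seq u ->
    supremums (range u) s -> l s = ereal_sup (range (l \o u))
}.

Definition functionals : set (S -> \bar R) := [set l | is_functional l].

Definition functionals_at (z : S) : set (S -> \bar R) :=
  [set l | functionals l /\ l z = 1].

Definition rank (x : S) (l : S -> \bar R) : \bar R := l x.

(* [ereal_inf set0 = +oo], which gives the value when no r is admissible. *)
Definition rank_ratio (x y : S) : \bar R :=
  ereal_inf [set r%:E | r in [set r : R | (0 < r)%R /\
    forall l, functionals l -> rank x l <= r%:E * rank y l]].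

End CuDefinitions.

Arguments functionals {d S} R _.
Arguments functionals_at {d S} R z _.
Arguments rank_ratio {d S} R x y.

(* Main.v *)
Require Import Defs.
From mathcomp Require Import all_boot all_order all_algebra.
From mathcomp Require Import all_classical all_reals.
From mathcomp Require Import ereal sequences.

(** A functional that vanishes at a full element is zero.  If rho(x,y) = 0, a
    functional with value 1 at y vanishes at x, which is a contradiction.
    Conversely, a functional with a finite nonzero value at y can be rescaled to
    value 1; if there is none, every functional takes the value 0 or oo at y,
    so that the rank of x is at most r times the rank of y for each r > 0. *)

Import Order.TTheory GRing.Theory Num.Theory.
Local Open Scope classical_set_scope.

Section Functionals.
Set Implicit Arguments.
Unset Strict Implicit.
Local Open Scope ring_scope.
Context {d : Order.disp_t} {S : pomType d}.

Lemma nondecreasing_mulrn (x : S) : nondecreasing_seq (fun n => x *+ n : S).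
Proof.
apply/nondecreasing_seqP => n.
rewrite mulrS -[leLHS]add0r; exact: pom_leD (pom_ge0 x) (lexx _).
Qed.

Lemma infty_mulP (x : S) :
  is_Cu S -> supremums (range (fun n => x *+ n : S)) (infty_mul x).
Proof.
(* The range contains [x *+ 0], so the default branch for the empty set is impossible. *)
move=> hS; rewrite /infty_mul /supremum; case: ifPn => [/eqP E|_].
  have : range (fun n => x *+ n : S) (x *+ 0) by exists 0%N.
  by rewrite E.
by apply: xgetPex; exact: Cu_O1 hS _ (nondecreasing_mulrn x).
Qed.

Context {R : realType}.
Implicit Type l : S -> \bar R.
Local Open Scope ereal_scope.

(** Fullness bounds [z] by the supremum of the multiples of [x]; [l] preserves this supremum and
    vanishes on each multiple. *)
Lemma functional_full_eq0 l (x z : S) :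
  is_Cu S -> is_functional l -> Full x -> l x = 0 -> l z = 0.
Proof.
move=> hS hl fx lx0; apply/eqP; rewrite eq_le functional_ge0// andbT.
apply: le_trans (functional_le hl (fx z)) _.
rewrite (functional_sup hl (nondecreasing_mulrn x) (infty_mulP x hS)).
apply: ge_ereal_sup => _ [n _ <-] /=.
elim: n => [|n IHn]; first by rewrite mulr0n functional0.
by rewrite mulrS functionalD// lx0 add0e.
Qed.

Lemma functional_scale l (c : R) :
  (0 < c)%R -> is_functional l -> is_functional (fun z => c%:E * l z).
Proof.
move=> c0 hl; have c0E : 0 <= c%:E by rewrite lee_fin ltW.
split=> [x||x y|x y xy|u s nu us].
- by rewrite mule_ge0// functional_ge0.
- by rewrite functional0// mule0.
- by rewrite functionalD// ge0_muleDr//; exact: functional_ge0.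
- by rewrite lee_pmul2l ?fin_numE// functional_le.
- by rewrite (functional_sup hl nu us) -ereal_sup_pZl// image_comp.
Qed.

Lemma functional_0_or_pinfty l (y : S) :
  functionals_at R y = set0 -> is_functional l -> l y = 0 \/ l y = +oo.
Proof.
move=> F0 hl; case E : (l y) (functional_ge0 hl y) => [c| |]//; last by right.
rewrite lee_fin le_eqVlt => /orP[/eqP <-|c0]; first by left.
have /seteqP[/(_ (fun z => c^-1%:E * l z)) + _] := F0.
case; split; first by apply: functional_scale; rewrite ?invr_gt0.
by rewrite E -EFinM mulVf ?gt_eqF.
Qed.

End Functionals.

Theorem lemma4p5 (R : realType) (d : Order.disp_t) (S : pomType d)
    (hS : is_Cu S) (x y : S) (hx : Full x) (hy : Full y) :
  rank_ratio R x y = 0%E <-> functionals_at R y = set0.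
Proof.
split=> [rho0|F0].
  apply/seteqP; split=> // l [hl ly1].
  suff lx0 : l x = 0%E.
    have := functional_full_eq0 y hS hl hx lx0.
    by rewrite ly1 => /eqP; rewrite onee_eq0.
  apply/eqP; rewrite eq_le functional_ge0// andbT.
  (* As [l y = 1], each admissible [r] bounds [l x]; the infimum being 0, some such [r] lies below
     [e]. *)
  apply/lee_addgt0Pr => e e0; rewrite add0e.
  have : (rank_ratio R x y < e%:E)%E by rewrite rho0 lte_fin.
  case/ereal_inf_lt => _ [r [_ rE] <-] /ltW re.
  by have := rE _ hl; rewrite /rank ly1 mule1 => /le_trans; apply.
apply/eqP; rewrite eq_le; apply/andP; split; last first.
  by apply: le_ereal_inf_tmp => _ [r [r0 _] <-]; rewrite lee_fin ltW.
apply/lee_addgt0Pr => e e0; rewrite add0e.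
(* Each [e > 0] is itself an admissible [r]. *)
apply: ereal_inf_lbound; exists e => //; split=> // l hl; rewrite /rank.
(* If [l y = 0], both sides vanish because [y] is full; if [l y = +oo], the right-hand side is [+oo]
   because [e] is positive. *)
have [ly0|->] := functional_0_or_pinfty F0 hl.
  by rewrite ly0 (functional_full_eq0 x hS hl hy ly0) mule0.
by rewrite gt0_muley ?leey ?lte_fin.
Qed.
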